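(* For an $n$-vertex graph $G$ with $m$ edges, \[ \alpha_1(G) \leq \frac{n^2}{2} - m. \] Equality holds if and only if there exist integers $r_1, \ldots, r_t \geq 1$ such that $G \cong K_{r_1, r_1} \vee \cdots \vee K_{r_t, r_t}$.
   Context: Graphs are finite and simple. For a graph $G$ with edge set $E(G)$, a set $A \subseteq E(G)$ is triangle-independent if it contains at most one edge from each triangle of $G$; $\alpha_1(G)$ denotes the maximum size of a triangle-independent set of edges in $G$. $K_{r,r}$ is the complete bipartite graph with both parts of size $r$. The join of graphs $G_1, \ldots, G_t$, written $G_1 \vee \cdots \vee G_t$, is the graph obtained from the disjoint union $G_1 + \cdots + G_t$ by adding all edges between vertices from different $G_i$. *)

(* Defs.v *)
From HB Require Import structures.
From mathcomp Require Import all_boot all_order all_algebra.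
Set Implicit Arguments.
Unset Strict Implicit.
Unset Printing Implicit Defensive.

Record sgraph := SGraph {
  vertex :> finType;
  adj : rel vertex;
  adj_sym : symmetric adj;
  adj_irr : irreflexive adj }.

Definition edges (G : sgraph) : {set {set G}} :=
  [set [set p.1; p.2] | p : G * G & adj p.1 p.2].

Definition triangle (G : sgraph) (x y z : G) : bool :=
  [&& adj x y, adj y z & adj x z].

Definition triangle_edges (G : sgraph) (x y z : G) : {set {set G}} :=
  [set [set x; y]; [set y; z]; [set x; z]].

Definition triangle_independent (G : sgraph) (A : {set {set G}}) : bool :=
  (A \subset edges G) &&
  [forall x : G, forall y : G, forall z : G,
     triangle x y z ==> (#|A :&: triangle_edges x y z| <= 1)].

Definition alpha1 (G : sgraph) : nat :=
  \max_(A : {set {set G}} | triangle_independent A) #|A|.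

Definition isomorphic (G H : sgraph) : Prop :=
  exists2 f : G -> H, bijective f & forall x y : G, adj (f x) (f y) = adj x y.

Section CompleteBipartite.
Variables r s : nat.

Definition Kbip_adj : rel ('I_r + 'I_s) := fun u v =>
  match u, v with
  | inl _, inr _ | inr _, inl _ => true
  | _, _ => false
  end.

Lemma Kbip_sym : symmetric Kbip_adj. Proof. by case=> ? []. Qed.
Lemma Kbip_irr : irreflexive Kbip_adj. Proof. by case. Qed.

Definition Kbip : sgraph := SGraph Kbip_sym Kbip_irr.
End CompleteBipartite.

Section Join.
Variables (t : nat) (G : 'I_t -> sgraph).

(* [tagged_as u v] is the vertex [v] transported to the graph containing [u];
   it is only meaningful when the tags agree, the other case being decided by
   the first disjunct. *)
Definition join_adj : rel {i : 'I_t & G i} := fun u v =>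
  (tag u != tag v) || adj (tagged u) (tagged_as u v).

Lemma join_sym : symmetric join_adj.
Proof.
move=> [i x] [j y]; rewrite /join_adj /= eq_sym.
case: eqP => //= eq_ji; case: i / eq_ji x => x.
by rewrite !tagged_asE adj_sym.
Qed.

Lemma join_irr : irreflexive join_adj.
Proof. by move=> [i x]; rewrite /join_adj eqxx /= tagged_asE adj_irr. Qed.

(* For [t = 0] this is the graph without vertices. *)
Definition join : sgraph := SGraph join_sym join_irr.
End Join.

(* Main.v *)
Require Import Defs.
From HB Require Import structures.
From mathcomp Require Import all_boot all_order all_algebra.
From mathcomp Require Import ring lra.
Set Implicit Arguments.
Unset Strict Implicit.
Unset Printing Implicit Defensive.
Import Order.TTheory GRing.Theory Num.Theory.
Local Open Scope ring_scope.

(** Let [e] be the relation "is an edge of [A]" for a triangle-independent [A],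
    [d] its degree function and [b x] the number of non-neighbours of [x] in
    [G], counting [x] itself.  The [e]-neighbours of [x] are non-neighbours of
    [y] whenever [e x y], so [d x <= b y] on every edge, and
      [sum_x d x <= sum_(e x y) d x / d y <= sum_y b y],
    the first step because [t + 1/t >= 2]; this is [2 #|A| + 2 m <= n^2].
    In case of equality every [d x] is positive and [d x = d y = b y] on edges,
    so the [e]-neighbours of [x] are exactly the non-neighbours of [y].  Hence
    non-adjacency is an equivalence relation whose classes are paired by [e]
    into balanced complete bipartite graphs. *)

(** * Degree sums of symmetric relations *)

Definition nbrs (T : finType) (e : rel T) (x : T) : {set T} := [set y | e x y].

Definition edge_set (T : finType) (e : rel T) : {set {set T}} :=
  [set [set p.1; p.2] | p : T * T & e p.1 p.2].

Lemma set2_eq (T : finType) (x y u v : T) :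
  [set x; y] = [set u; v] -> x = u /\ y = v \/ x = v /\ y = u.
Proof.
move=> E.
have := set21 x y; rewrite E => /set2P Hx.
have := set22 x y; rewrite E => /set2P Hy.
have := set21 u v; rewrite -E => /set2P Hu.
have := set22 u v; rewrite -E => /set2P Hv.
case: Hx => Hx; case: Hy => Hy; case: Hu => Hu; case: Hv => Hv;
  by [left; split; congruence | right; split; congruence].
Qed.

Lemma mem_edge_set (T : finType) (e : rel T) (x y : T) :
  symmetric e -> ([set x; y] \in edge_set e) = e x y.
Proof.
move=> e_sym; apply/imsetP/idP => [[[u v]]|exy]; last first.
  by exists (x, y); rewrite ?inE.
by rewrite inE /= => euv /set2_eq[[-> ->]|[-> ->]] //; rewrite e_sym.
Qed.

Lemma handshake (T : finType) (e : rel T) : symmetric e -> irreflexive e ->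
  (\sum_x #|nbrs e x| = #|edge_set e|.*2)%N.
Proof.
move=> e_sym e_irr.
under eq_bigr => x _ do rewrite -sum1_card.
rewrite pair_big_dep /= (eq_bigl (fun p => e p.1 p.2)); last first.
  by move=> p; rewrite inE.
(* Group the ordered pairs by the unordered edge they span; by irreflexivity each fibre consists of
   exactly two pairs. *)
rewrite (partition_big_imset (fun p : T * T => [set p.1; p.2])) /=.
rewrite (eq_bigr (fun=> 2%N)); first last.
  move=> s /imsetP[[x y] exy ->] /=; rewrite unfold_in /= in exy.
  have nxy : x != y by apply: contraTneq exy => ->; rewrite e_irr.
  rewrite sum1_card (_ : 2%N = #|[set (x, y); (y, x)]|); last first.
    by rewrite cards2 xpair_eqE (negPf nxy).
  apply: eq_card => -[u v]; rewrite !inE unfold_in /= !xpair_eqE.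
  apply/andP/orP => [[_ /eqP/set2_eq]|].
    by case=> [] [-> ->]; rewrite !eqxx; auto.
  case=> /andP[/eqP-> /eqP->]; rewrite unfold_in /= ?exy ?eqxx //.
  by rewrite e_sym exy setUC eqxx.
rewrite sum_nat_const muln2; congr (_.*2); apply: eq_card => s.
by apply/imsetP/imsetP => -[p pe ->]; exists p; rewrite ?inE in pe *.
Qed.

(* Averaging [d x <= b y] over the edges with weight [1 / d y], and using
   [d x / d y + d y / d x >= 2]; the slack is written out so that the
   equality case can be read off termwise. *)
Lemma degree_sum_identity (T : finType) (e : rel T) (b : T -> nat) :
    symmetric e ->
  let d x := #|nbrs e x|%:R : rat in
  \sum_y ((b y)%:R - d y) =
  \sum_y ((if d y == 0 then (b y)%:R else 0) +
          \sum_(x | e x y) (((b y)%:R - d x) / d y +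
                            (d x - d y) ^+ 2 / (2 * d x * d y))).
Proof.
move=> e_sym d.
have d_neq0 x y : e x y -> d x != 0.
  by move=> exy; rewrite pnatr_eq0 -lt0n; apply/card_gt0P; exists y; rewrite inE.
(* [F] is antisymmetric, so it sums to zero over the symmetric relation [e]; adding it turns
   [b y / d y - 1] into the two slack terms of the statement. *)
pose F x y := (d y / d x - d x / d y) / 2.
have F0 : \sum_y \sum_(x | e x y) F x y = 0.
  suff: \sum_y \sum_(x | e x y) F x y = - \sum_y \sum_(x | e x y) F x y by lra.
  rewrite [in LHS](exchange_big_dep xpredT) //= -sumrN; apply: eq_bigr => y _.
  rewrite -sumrN; apply: eq_big => [x|x _]; first by rewrite e_sym.
  by rewrite /F; lra.
rewrite -[LHS]addr0 -[X in _ + X = _]F0 -big_split /=; apply: eq_bigr => y _.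
transitivity ((if d y == 0 then (b y)%:R else 0) +
   \sum_(x | e x y) (((b y)%:R / d y - 1) + F x y)).
  rewrite big_split /= addrA; congr (_ + _).
  have -> : \sum_(x | e x y) ((b y)%:R / d y - 1) = ((b y)%:R / d y - 1) * d y.
    rewrite [in RHS]mulr_natr sumr_const; congr (_ *+ _).
    by apply: eq_card => x; rewrite !inE unfold_in e_sym.
  (* If [d y = 0], the sum over [x] is empty, and the [if] term accounts for [b y]. *)
  by case: eqP => [->|/eqP dy]; [rewrite mulr0; ring | field].
congr (_ + _); apply: eq_bigr => x exy; rewrite /F.
have dx := d_neq0 _ _ exy; have dy : d y != 0 by apply: (d_neq0 y x); rewrite e_sym.
by field; rewrite dx dy.
Qed.

(** All terms in [degree_sum_identity] are nonnegative, so equality makes each vanish: the [if] term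
    gives positivity of the degree, the two slack terms give the two equalities on edges. *)
Lemma degree_sum_bound (T : finType) (e : rel T) (b : T -> nat) :
    symmetric e -> (forall x y, e x y -> #|nbrs e x| <= b y)%N ->
  (\sum_x #|nbrs e x| <= \sum_x b x)%N /\
  (\sum_x #|nbrs e x| = \sum_x b x -> forall y,
     (0 < b y -> 0 < #|nbrs e y|)%N /\
     forall x, e x y -> #|nbrs e x| = b y /\ #|nbrs e x| = #|nbrs e y|)%N.
Proof.
move=> e_sym le_db; have := degree_sum_identity b e_sym => /=.
set d := fun x => #|nbrs e x|%:R : rat => Esum.
have d_ge0 x : 0 <= d x by exact: ler0n.
have d_gt0 x y : e x y -> 0 < d x.
  by move=> exy; rewrite ltr0n; apply/card_gt0P; exists y; rewrite inE.
have t1 x y : e x y -> 0 <= ((b y)%:R - d x) / d y.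
  by move=> exy; rewrite divr_ge0 // subr_ge0 ler_nat le_db.
have t2 x y : 0 <= (d x - d y) ^+ 2 / (2 * d x * d y).
  by rewrite divr_ge0 ?sqr_ge0 // !mulr_ge0.
have s1 y : 0 <= \sum_(x | e x y)
    (((b y)%:R - d x) / d y + (d x - d y) ^+ 2 / (2 * d x * d y)).
  by apply: sumr_ge0 => x exy; rewrite addr_ge0 ?t1.
have s0 y : 0 <= (if d y == 0 then (b y)%:R else 0 : rat).
  by case: ifP => // _; exact: ler0n.
have Ediff : \sum_y ((b y)%:R - d y) =
    (\sum_x b x)%N%:R - (\sum_x #|nbrs e x|)%N%:R.
  by rewrite sumrB !natr_sum.
split.
  rewrite -(ler_nat rat) -subr_ge0 -Ediff Esum.
  by apply: sumr_ge0 => y _; exact: addr_ge0 (s0 y) (s1 y).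
move=> E y; move: Ediff; rewrite E subrr Esum => /psumr_eq0P.
move=> /(_ (fun y _ => addr_ge0 (s0 y) (s1 y)) y isT) /eqP.
rewrite (paddr_eq0 (s0 y) (s1 y)) => /andP[/eqP z0 /eqP z1]; split=> [by_gt0|x exy].
  rewrite lt0n -(pnatr_eq0 rat); apply/negP => dy0.
  by move: z0; rewrite /d dy0 => /eqP; rewrite pnatr_eq0 eqn0Ngt by_gt0.
have := psumr_eq0P (fun x exy => addr_ge0 (t1 x y exy) (t2 x y)) z1 exy.
have dx := d_gt0 x y exy; have dy : 0 < d y by apply: (d_gt0 y x); rewrite e_sym.
move/eqP; rewrite paddr_eq0 ?t1 // => /andP[].
rewrite !mulf_eq0 !invr_eq0 !mulf_eq0 !(gt_eqF dx) !(gt_eqF dy) !orbF orbb.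
by rewrite !subr_eq0 !eqr_nat => /eqP-> /eqP->.
Qed.

(** * Triangle-independent sets as symmetric relations *)

Section Graph.

Variable G : sgraph.
Implicit Types (e : rel G) (A : {set {set G}}) (x y z : G).

Lemma triangle_independent_edge_set e : symmetric e -> subrel e (@adj G) ->
    (forall x y z, e x y -> e y z -> ~~ adj x z) ->
  triangle_independent (edge_set e).
Proof.
move=> e_sym e_adj e_indep; apply/andP; split.
  apply/subsetP => s /imsetP[p]; rewrite inE => /e_adj adj_p ->.
  by apply/imsetP; exists p; rewrite ?inE.
apply/forallP => x; apply/forallP => y; apply/forallP => z.
apply/implyP => /and3P[axy ayz axz].
(* Two edges of a triangle form a path whose ends are adjacent; [n1], [n2], [n3] exclude the three
   possible pairs. *)
have n1 : ~~ (e x y && e y z).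
  by apply/negP => /andP[exy eyz]; have := e_indep _ _ _ exy eyz; rewrite axz.
have n2 : ~~ (e x y && e x z).
  apply/negP => /andP[exy exz]; rewrite e_sym in exy.
  by have := e_indep _ _ _ exy exz; rewrite ayz.
have n3 : ~~ (e y z && e x z).
  apply/negP => /andP[eyz exz]; rewrite e_sym in eyz.
  by have := e_indep _ _ _ exz eyz; rewrite axy.
apply/card_le1_eqP => s1 s2; rewrite !inE -!orbA.
case/andP=> Hs1 /or3P[] /eqP E1; case/andP=> Hs2 /or3P[] /eqP E2; subst s1 s2 => //;
  move: n1 n2 n3; rewrite !mem_edge_set // in Hs1 Hs2; by rewrite Hs1 Hs2 ?andbF.
Qed.

Lemma triangle_independentP A : triangle_independent A ->
  let e : rel G := fun x y => [set x; y] \in A in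
  [/\ symmetric e, subrel e (@adj G),
      forall x y z, e x y -> e y z -> ~~ adj x z & edge_set e = A].
Proof.
move=> /andP[/subsetP A_edges A_tri] e.
have e_sym : symmetric e by move=> x y; rewrite /e setUC.
have e_adj : subrel e (@adj G).
  by move=> x y /A_edges; rewrite (mem_edge_set _ _ (@adj_sym G)).
split=> //.
  move=> x y z exy eyz; apply/negP => axz.
  move/forallP/(_ x)/forallP/(_ y)/forallP/(_ z)/implyP: A_tri.
  have tri : triangle x y z by rewrite /triangle (e_adj _ _ exy) (e_adj _ _ eyz).
  move=> /(_ tri)/card_le1_eqP/(_ [set x; y] [set y; z]).
  rewrite !inE !eqxx !orbT !andbT => /(_ exy eyz) /set2_eq[[_ ezy]|[_ ezx]].
    by have := e_adj _ _ eyz; rewrite ezy adj_irr.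
  by rewrite ezx adj_irr in axz.
apply/setP => s; apply/imsetP/idP => [[p]|sA]; first by rewrite inE => ? ->.
have /imsetP[p _ Es] := A_edges s sA.
by exists p => //; rewrite inE /e -Es.
Qed.

Lemma alpha1_witness : exists e, [/\ symmetric e, subrel e (@adj G),
  forall x y z, e x y -> e y z -> ~~ adj x z & alpha1 G = #|edge_set e|].
Proof.
have ti0 : triangle_independent (set0 : {set {set G}}).
  rewrite /triangle_independent sub0set; do 3![apply/forallP => ?].
  by rewrite set0I cards0 implybT.
have [A /triangle_independentP[e1 e2 e3 e4] EA] :=
  eq_bigmax_cond (fun A => #|A|) (introT card_gt0P (ex_intro _ set0 ti0)).
by eexists; split; [exact: e1 | exact: e2 | exact: e3 | rewrite e4].
Qed.

Lemma sum_nonnbrs :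
  (\sum_x #|~: nbrs (@adj G) x| + #|edges G|.*2 = #|G| * #|G|)%N.
Proof.
rewrite -(handshake (@adj_sym G) (@adj_irr G)) -big_split /=.
under eq_bigr => x _ do rewrite addnC cardsC.
by rewrite sum_nat_const.
Qed.

(** * Recovering the join from the equality case *)

Section PairedClasses.

Variable e : rel G.
Hypothesis e_sym : symmetric e.
Hypothesis e_adj : subrel e (@adj G).
Hypothesis nonadjE : forall x y z, e x y -> ~~ adj y z = e x z.
Hypothesis e_card : forall x y, e x y -> #|nbrs e x| = #|nbrs e y|.
Hypothesis e_gt0 : forall x, (0 < #|nbrs e x|)%N.

(** A chosen partner of [x]: by [nonadjE], the [e]-neighbours of [p x] are the non-neighbours of
    [x], that is, the part containing [x]. By [e_gt0] the default is never taken. *)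
Let p x := odflt x [pick y | e x y].

Let ep x : e x (p x).
Proof.
rewrite /p; case: pickP => //= e0.
by have /card_gt0P[y] := e_gt0 x; rewrite inE e0.
Qed.

Let pe x : e (p x) x. Proof. by rewrite e_sym. Qed.

(* The union of the part of [x] and of the part paired with it. *)
Let block : rel G := fun x y => ~~ adj x y || e x y.

Let block_eq x y : block x y -> block x =1 block y.
Proof.
(* Non-adjacent vertices have the same [e]-neighbours [z], because the non-neighbours of [x'] are
   the [e]-neighbours of [z]. *)
have Ne x' y' z : ~~ adj x' y' -> e x' z -> e y' z.
  by move=> Nxy exz; rewrite e_sym -(@nonadjE _ x') // e_sym.
case/orP=> [Nxy|exy] z; rewrite /block; last first.
  rewrite (nonadjE _ exy) orbC; congr (_ || _).
  by rewrite (@nonadjE y) // e_sym.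
congr (_ || _).
  have Ex := nonadjE _ (pe x).
  by rewrite Ex -(@nonadjE (p x) y) // -Ex.
apply/idP/idP; first exact: Ne.
by apply: Ne; rewrite adj_sym.
Qed.

Let block_refl x : block x x. Proof. by rewrite /block adj_irr. Qed.

Let block_sym x y : block x y = block y x.
Proof. by rewrite /block adj_sym e_sym. Qed.

(** [pick] depends only on the extension of the predicate, so [block_eq] gives all vertices of a
    block one representative. *)
Let rep x := odflt x [pick y | block x y].

Let block_rep x : block x (rep x).
Proof. by rewrite /rep; case: pickP => //= /(_ x); rewrite block_refl. Qed.

Let rep_eq x y : block x y -> rep x = rep y.
Proof.
move=> bxy; rewrite /rep (eq_pick (block_eq bxy)).
by case: pickP => //= /(_ y); rewrite block_refl.
Qed.

Let reps : {set G} := [set x | rep x == x].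

Let rep_reps x : rep x \in reps.
Proof. by rewrite inE -(rep_eq (block_rep x)). Qed.

Let c (i : 'I_#|reps|) : G := enum_val i.

Let c_inj i j : block (c i) (c j) -> i = j.
Proof.
move=> /rep_eq; have := enum_valP i; have := enum_valP j.
by rewrite !inE => /eqP-> /eqP-> /enum_val_inj.
Qed.

Let r i := #|nbrs e (c i)|.

Let Kjoin := join (fun i => Kbip (r i) (r i)).

(** The left side enumerates the part paired with that of [c i], the right side the part of [c i]
    itself; [e_card] makes both of size [r i], so the [nth] default is never reached. *)
Let g (u : Kjoin) : G := let: existT i s := u in
  match s with
  | inl k => nth (c i) (enum (nbrs e (c i))) k
  | inr k => nth (c i) (enum (nbrs e (p (c i)))) k
  end.

Let lt_l i (k : 'I_(r i)) : (k < size (enum (nbrs e (c i))))%N.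
Proof. by rewrite -cardE. Qed.

Let lt_r i (k : 'I_(r i)) : (k < size (enum (nbrs e (p (c i)))))%N.
Proof. by rewrite -cardE -(e_card (ep _)). Qed.

Let g_l i k : e (c i) (g (existT _ i (inl k))).
Proof. by have := mem_nth (c i) (lt_l k); rewrite mem_enum inE. Qed.

Let g_l_sym i k : e (g (existT _ i (inl k))) (c i).
Proof. by rewrite e_sym. Qed.

Let g_r i k : e (p (c i)) (g (existT _ i (inr k))).
Proof. by have := mem_nth (c i) (lt_r k); rewrite mem_enum inE. Qed.

Let block_g u : block (c (tag u)) (g u).
Proof.
case: u => i [k|k]; rewrite /block.
  by rewrite g_l orbT.
by rewrite (nonadjE _ (pe _)) g_r.
Qed.

Let g_adj u v : adj (g u) (g v) = adj u v.
Proof.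
have := block_g u; have := block_g v.
case: u => i s; case: v => j s'; rewrite [RHS]/adj /= /join_adj /=.
case: (eqVneq i j) => /= [ij|nij] bv bu; last first.
  (* Non-adjacent images lie in one block, and distinct representatives lie in distinct blocks. *)
  apply: contraNT nij => Nuv; apply/eqP/c_inj.
  by rewrite (block_eq bu) block_sym (block_eq bv) block_sym /block Nuv.
case: j / ij s' {bu bv} => s'; rewrite tagged_asE.
case: s s' => k [] k'.
- by apply: negbTE; rewrite (nonadjE _ (g_l k)) g_l.
- by apply: e_adj; rewrite -(nonadjE _ (g_l_sym k)) (nonadjE _ (pe _)) g_r.
- rewrite adj_sym; apply: e_adj.
  by rewrite -(nonadjE _ (g_l_sym k')) (nonadjE _ (pe _)) g_r.
- by apply: negbTE; rewrite (nonadjE _ (g_r k)) g_r.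
Qed.

(** Equal images are non-adjacent, so by [g_adj] the arguments lie on the same side of the same
    factor, which is enumerated without repetition. *)
Let g_inj : injective g.
Proof.
move=> u v guv; have := adj_irr (g u); rewrite {2}guv g_adj.
case: u guv => i s; case: v => j s'; rewrite /adj /= /join_adj /=.
case: (eqVneq i j) => //= ij; case: j / ij s' => s'; rewrite tagged_asE.
case: s s' => k [] k' //= /eqP; rewrite nth_uniq ?enum_uniq //.
  by move=> /eqP/val_inj->.
by move=> /eqP/val_inj->.
Qed.

Let g_surj x : exists u, g u = x.
Proof.
pose i := enum_rank_in (rep_reps x) (rep x).
have ci : c i = rep x by rewrite /c enum_rankK_in.
have := block_rep x; rewrite block_sym -ci => /orP[Ncx|ecx].
  rewrite (nonadjE _ (pe _)) in Ncx.
  have xN : x \in enum (nbrs e (p (c i))) by rewrite mem_enum inE.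
  have lk : (index x (enum (nbrs e (p (c i)))) < r i)%N.
    by rewrite /r (e_card (ep _)) cardE index_mem.
  by exists (existT _ i (inr (Ordinal lk))); rewrite /= nth_index.
have xN : x \in enum (nbrs e (c i)) by rewrite mem_enum inE.
have lk : (index x (enum (nbrs e (c i))) < r i)%N by rewrite /r cardE index_mem.
by exists (existT _ i (inl (Ordinal lk))); rewrite /= nth_index.
Qed.

Lemma paired_classes_join : exists (t : nat) (r : 'I_t -> nat),
  (forall i, (1 <= r i)%N) /\ isomorphic G (join (fun i => Kbip (r i) (r i))).
Proof.
exists #|reps|, r; split=> [i|]; first exact: e_gt0.
have g_surjb x : [exists u, g u == x].
  by have [u gu] := g_surj x; apply/existsP; exists u; apply/eqP.
pose h x := xchoose (existsP (g_surjb x)).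
have gh : cancel h g by move=> x; apply/eqP/(xchooseP (existsP (g_surjb x))).
exists h; last by move=> x y; rewrite -g_adj !gh.
by exists g => // u; apply: g_inj; rewrite gh.
Qed.

End PairedClasses.

(** * Joins attain the bound *)

(** Take the edges inside the factors. Swapping the two sides of every factor maps the
    non-neighbours of [x], which form its own side, bijectively onto its [e]-neighbours. *)
Lemma join_matching t (r : 'I_t -> nat) :
    isomorphic G (join (fun i => Kbip (r i) (r i))) ->
  exists e, [/\ symmetric e, subrel e (@adj G),
    forall x y z, e x y -> e y z -> ~~ adj x z &
    forall x, #|nbrs e x| = #|~: nbrs (@adj G) x|].
Proof.
case=> f [f' fK f'K] f_adj.
pose e : rel G := fun x y => (tag (f x) == tag (f y)) && adj x y.
pose swap (u : join (fun i => Kbip (r i) (r i))) :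
    join (fun i => Kbip (r i) (r i)) := let: existT i s := u in
  existT _ i (match s with inl k => inr k | inr k => inl k end).
have swapK : involutive swap by case=> i [].
have eP x y : e x (f' (swap (f y))) = ~~ adj x y.
  rewrite /e -!f_adj f'K; case: (f x) (f y) => i s [j s'].
  rewrite /adj /= /join_adj /=; case: (eqVneq i j) => //= ij.
  by case: j / ij s' => s'; rewrite !tagged_asE; case: s s' => ? [].
exists e; split.
- by move=> x y; rewrite /e eq_sym adj_sym.
- by move=> x y /andP[].
- move=> x y z; rewrite /e -!f_adj.
  case: (f x) (f y) (f z) => i s [j s'] [k s''] /=.
  rewrite /adj /= /join_adj /=; case: eqVneq => //= ij; case: j / ij s' => s'.
  case: eqVneq => //= ik; case: k / ik s'' => s''.
  by rewrite !tagged_asE; case: s s' s'' => ? [] ? [].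
move=> x; have inj_h : injective (fun y => f' (swap (f y))).
  by apply: inj_comp (can_inj f'K) (inj_comp (inv_inj swapK) (can_inj fK)).
rewrite -[RHS](card_imset _ inj_h); apply: eq_card => y.
apply/idP/imsetP => [exy|[z]]; last by rewrite !inE -eP => ? ->.
exists (f' (swap (f y))); rewrite ?f'K ?swapK ?fK //.
by move: exy; rewrite !inE -eP f'K swapK fK.
Qed.

Lemma nbrs_bound e : symmetric e ->
    (forall x y z, e x y -> e y z -> ~~ adj x z) ->
  forall x y, e x y -> nbrs e x \subset ~: nbrs (@adj G) y.
Proof.
move=> e_sym e_indep x y exy; apply/subsetP => z; rewrite !inE => exz.
by apply: e_indep exz; rewrite e_sym.
Qed.

(** * The bound and its equality case, doubled to stay in the natural numbers *)

Lemma alpha1_bound : ((alpha1 G).*2 + #|edges G|.*2 <= #|G| * #|G|)%N /\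
  (((alpha1 G).*2 + #|edges G|.*2 = #|G| * #|G|)%N <->
   exists (t : nat) (r : 'I_t -> nat), (forall i, (1 <= r i)%N) /\
     isomorphic G (join (fun i => Kbip (r i) (r i)))).
Proof.
have e_irr e : subrel e (@adj G) -> irreflexive e.
  by move=> e_adj x; apply/negP => /e_adj; rewrite adj_irr.
have [e [e_sym e_adj e_indep alphaE]] := alpha1_witness.
have e_nbrs := nbrs_bound e_sym e_indep.
have [le_db eq_db] := degree_sum_bound e_sym
  (fun x y exy => subset_leq_card (e_nbrs x y exy)).
rewrite -sum_nonnbrs alphaE -handshake // ?leq_add2r; last exact: e_irr.
split=> //; split=> [/addIn/eq_db {}eq_db|[t [r [_ /join_matching]]]].
  apply: (@paired_classes_join e) => //.
  - move=> x y z exy; have [_ /(_ x exy)[dx _]] := eq_db y.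
    (* The inclusion [e_nbrs] between sets of equal size is an equality; this is [nonadjE]. *)
    have /eqP/setP/(_ z) : nbrs e x == ~: nbrs (@adj G) y.
      by rewrite eqEcard e_nbrs // dx /=.
    by rewrite !inE.
  - by move=> x y exy; have [_ /(_ x exy)[]] := eq_db y.
  - move=> x; apply: (eq_db x).1; apply/card_gt0P; exists x.
    by rewrite !inE adj_irr.
case=> e' [e'_sym e'_adj e'_indep d_eq].
(* The non-neighbour counts are the degrees of [e'], so they sum to twice the size of a
   triangle-independent set, at most twice [alpha1 G]. *)
apply/eqP; rewrite eqn_add2r eqn_leq le_db /=.
under [X in (X <= _)%N]eq_bigr => x _ do rewrite -d_eq.
rewrite handshake //; last exact: e_irr.
rewrite handshake //; last exact: e_irr.
rewrite leq_double -alphaE.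
exact: (leq_bigmax_cond (F := fun A => #|A|) _
          (triangle_independent_edge_set e'_sym e'_adj e'_indep)).
Qed.

End Graph.

Theorem theorem3p2 (G : sgraph) (n m : nat)
    (hn : #|G| = n) (hm : #|edges G| = m) :
  (alpha1 G)%:R <= n%:R ^+ 2 / 2 - m%:R :> rat
  /\ ((alpha1 G)%:R = n%:R ^+ 2 / 2 - m%:R :> rat
      <-> exists (t : nat) (r : 'I_t -> nat),
            (forall i : 'I_t, (1 <= r i)%N)
            /\ isomorphic G (join (fun i : 'I_t => Kbip (r i) (r i)))).
Proof.
have [bound eq_iff] := alpha1_bound G; rewrite hn hm in bound eq_iff.
rewrite -{}eq_iff; split.
  by move: bound; rewrite -(ler_nat rat) natrD natrM -!muln2 !natrM; lra.
split=> E; last first.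
  by have := congr1 (fun k => k%:R : rat) E; rewrite natrD natrM -!muln2 !natrM; lra.
by apply/eqP; rewrite -(eqr_nat rat) natrD natrM -!muln2 !natrM E; apply/eqP; field.
Qed.
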